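(* Let $X$ be a Banach space such that $X^*$ is isometrically isomorphic to $\ell_1$. Then $X$ has property A$^k$.
   Context: Banach spaces are over $\mathbb{R}$ or $\mathbb{C}$ (the same field for all spaces involved). For Banach spaces $X,Z$, $K(X,Z)$ is the space of compact linear operators from $X$ into $Z$ with the operator norm, and $NA(X,Z)$ is the set of bounded linear operators $T:X\to Z$ attaining their norm, i.e. such that $\|T\|=\|Tx\|$ for some $x\in X$ with $\|x\|=1$. A Banach space $X$ has property A$^k$ if $K(X,Z)\cap NA(X,Z)$ is dense in $K(X,Z)$ for every Banach space $Z$. *)

(* Defs.v *)
From HB Require Import structures.
From mathcomp Require Import all_boot all_order all_algebra.
From mathcomp Require Import all_classical all_reals all_analysis.
From mathcomp Require Export complex.

Set Implicit Arguments.
Unset Strict Implicit.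
Unset Printing Implicit Defensive.

Import Order.TTheory GRing.Theory Num.Theory.
Import numFieldNormedType.Exports.

Local Open Scope classical_set_scope.
Local Open Scope ring_scope.

(* Everything is defined over a numFieldType K so as to cover the two scalar  *)
(* fields K = R and K = R[i] (R : realType) at once. Norms over R[i] are      *)
(* K-valued, and since z <= t in R[i] means that t - z is a nonnegative real, *)
(* suprema and limits of norms and bounds 0 < e are the usual real ones.      *)

Section operators.
Context {K : numFieldType}.
Implicit Types X Z : normedModType K.

Definition unit_ball X : set X := [set x | `|x| <= 1].

(* supremum 0 is the generic form of the library's sup for reals; on bounded  *)
(* operators the supremum exists for K = R and K = R[i].                      *)
Definition opnorm X Z (T : X -> Z) : K :=
  supremum 0 [set `|T x| | x in @unit_ball X].

Definition bounded_ops X Z : set (X -> Z) :=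
  [set T | linear T /\ [bounded T x | x in @unit_ball X]].

Definition compact_ops X Z : set (X -> Z) :=
  [set T | linear T /\ precompact (T @` @unit_ball X)].

Definition NA X Z : set (X -> Z) :=
  [set T | @bounded_ops X Z T /\ exists2 x : X, `|x| = 1 & opnorm T = `|T x|].

Definition dual X : set (X -> K^o) := @bounded_ops X K^o.

Definition property_Ak X : Prop :=
  forall (Z : completeNormedModType K) (T : X -> Z), compact_ops T ->
  forall e : K, 0 < e ->
  exists S : X -> Z, [/\ compact_ops S, NA S & opnorm (T - S) < e].

End operators.

Section ell1.
Context {K : numFieldType}.

Definition ell1 : set (nat -> K^o) := [set u | cvgn ([normed series u] : nat -> K^o)].

Definition ell1_norm (u : nat -> K^o) : K := limn ([normed series u] : nat -> K^o).

End ell1.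

(* A and B are linear subspaces of V and W, normed by nA and nB.              *)
Definition isometrically_isomorphic {K : numFieldType} {V W : lmodType K}
    (A : set V) (nA : V -> K) (B : set W) (nB : W -> K) : Prop :=
  exists Phi : V -> W,
    [/\ forall (a : K) (f g : V), A f -> A g ->
          Phi (a *: f + g) = a *: Phi f + Phi g,
        set_bij A B Phi
      & forall f, A f -> nB (Phi f) = nA f].

Definition dual_is_ell1 {K : numFieldType} (X : normedModType K) : Prop :=
  isometrically_isomorphic (@dual K X) (@opnorm K X K^o) (@ell1 K) ell1_norm.

(* Main.v *)
(* Let e_m be the functionals forming the l1-basis of X^*, and N_n the common
   kernel of e_0, ..., e_(n-1).

   Lifting: if |c_i| <= 1 for i < n, some x in the closed unit ball of X satisfies
   e_i x = c_i for all i < n. Start from any x0 with these values and |x0| <= 1 + d;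
   for each h > 0 there is y in N_n with |y| <= d (1 + h) and |x0 + y| <= 1 + h.
   Otherwise Hahn-Banach in X * X, normed by max(|u|/d, |v|), separates (0, x0) from
   {(y, y) | y in N_n} by (phi, psi) with d |phi| + |psi| <= 1; as phi + psi vanishes
   on N_n, phi and psi have opposite l1-coordinates from n on, which forces
   |psi x0| <= |psi| + d |phi| <= 1, a contradiction. Iterating with d = D / 2^k, the
   corrections converge to the lifting.

   Approximation: if T is compact, |T| is small on the unit ball of N_n for n large,
   for otherwise points x_n of these balls have T x_n clustering at some z <> 0, while
   the l1-tails of g o T tend to 0 for a functional g norming z. Combined with liftings,
   this gives S x = \sum_(i < n) e_i x *: z_i close to T. By the lifting property, S maps
   the unit ball onto the compact set of all \sum_(i < n) t_i *: z_i with |t_i| <= 1, so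
   S attains its norm. *)

Require Import Defs.
From HB Require Import structures.
From mathcomp Require Import all_boot all_order all_algebra.
From mathcomp Require Import all_classical all_reals all_analysis.
From mathcomp Require Import ring lra.

Set Implicit Arguments.
Unset Strict Implicit.
Unset Printing Implicit Defensive.

Import Order.TTheory GRing.Theory Num.Theory.
Import numFieldNormedType.Exports.
Local Open Scope classical_set_scope.
Local Open Scope ring_scope.

(** * Hahn-Banach theorem *)

Section real_hahn_banach.
Context {R : realType} {V : lmodType R}.
Implicit Types (p q : V -> R) (C : set (V * R)).

Definition sublinear q :=
  (forall u v, q (u + v) <= q u + q v) /\
  (forall a u, 0 <= a -> q (a *: u) = a * q u).

Lemma sublinear0 q : sublinear q -> q 0 = 0.
Proof. by case=> _ qZ; rewrite -(scale0r 0) qZ// mul0r. Qed.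

Lemma sublinear_geN q x : sublinear q -> - q (- x) <= q x.
Proof.
move=> sq; have [qD _] := sq.
by have := qD x (- x); rewrite subrr sublinear0// -lerBlDr sub0r.
Qed.

Definition convex_cone C := [/\ C (0, 0),
  forall s t, C s -> C t -> C (s.1 + t.1, s.2 + t.2) &
  forall a s, 0 <= a -> C s -> C (a *: s.1, a * s.2)].

(* The largest sublinear q' <= q with q' (- y) <= - t for every (y, t) in C. *)
Definition lower_by q C x := inf [set q (x + s.1) - s.2 | s in C].

Section lower_by.
Variables (q : V -> R) (C : set (V * R)).
Hypotheses (sq : sublinear q) (cC : convex_cone C)
  (Cq : forall s, C s -> s.2 <= q s.1).

(** The infimum is finite: q s.1 <= q (x + s.1) + q (- x) by subadditivity, and [Cq] bounds s.2 by q
    s.1. *)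
Let lower_by_lb x : lbound [set q (x + s.1) - s.2 | s in C] (- q (- x)).
Proof.
move=> _ [s Cs <-]; have [qD _] := sq.
have := qD (x + s.1) (- x); rewrite addrAC subrr add0r.
by have := Cq Cs; lra.
Qed.

Let lower_by_neq0 x : [set q (x + s.1) - s.2 | s in C] !=set0.
Proof. by exists (q (x + 0) - 0); exists (0, 0) => //; case: cC. Qed.

Let lower_by_inf x s : C s -> lower_by q C x <= q (x + s.1) - s.2.
Proof.
by move=> Cs; apply: ge_inf; [exists (- q (- x)); exact: lower_by_lb|exists s].
Qed.

Lemma lower_by_le x : lower_by q C x <= q x.
Proof.
by have [C0 _ _] := cC; have := lower_by_inf x C0; rewrite /= addr0 subr0.
Qed.

Lemma lower_by_opp s : C s -> lower_by q C (- s.1) <= - s.2.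
Proof.
by move=> /(lower_by_inf (- s.1)); rewrite addNr (sublinear0 sq) sub0r.
Qed.

Lemma sublinear_lower_by : sublinear (lower_by q C).
Proof.
have [qD qZ] := sq; have [_ CD CZ] := cC.
(* For a > 0 one inequality is enough: the other is this one for a^-1 at the vector a *: u. *)
have LZ a u : 0 < a -> lower_by q C (a *: u) <= a * lower_by q C u.
  move=> a0; rewrite mulrC -ler_pdivrMr//.
  apply: lb_le_inf => // _ [s Cs <-]; rewrite ler_pdivrMr//.
  have := lower_by_inf (a *: u) (CZ _ _ (ltW a0) Cs).
  rewrite /= -scalerDr (qZ _ _ (ltW a0)) => h; apply: le_trans h _.
  by rewrite mulrBl mulrC [s.2 * _]mulrC.
split=> [u v|a u].
  rewrite -lerBlDr; apply: lb_le_inf => // _ [s Cs <-].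
  rewrite lerBlDl -lerBlDr; apply: lb_le_inf => // _ [t Ct <-].
  have := lower_by_inf (u + v) (CD _ _ Cs Ct) => /=.
  have := qD (u + s.1) (v + t.1); rewrite addrACA; lra.
rewrite le_eqVlt => /predU1P[<-|a0].
  rewrite scale0r mul0r; apply/eqP; rewrite eq_le -{1}(sublinear0 sq) lower_by_le/=.
  by apply: lb_le_inf => // y /lower_by_lb; rewrite oppr0 (sublinear0 sq) oppr0.
apply/eqP; rewrite eq_le LZ//= mulrC -ler_pdivlMr//.
have := LZ a^-1 (a *: u); rewrite invr_gt0 scalerA mulVf ?gt_eqF// scale1r.
by rewrite mulrC; apply.
Qed.

End lower_by.

(** Zorn's lemma for the reversed pointwise order. A nonempty chain has its pointwise infimum as
    bound, finite because every sublinear t <= p satisfies - p (- x) <= t x. *)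
Lemma minimal_sublinear p : sublinear p ->
  exists q, [/\ sublinear q, forall x, q x <= p x &
    forall q', sublinear q' -> (forall x, q' x <= q x) -> q' = q].
Proof.
move=> sp.
pose T := {q | sublinear q /\ forall x, q x <= p x}.
pose below (s t : T) := `[< forall x, sval t x <= sval s x >].
have svalI (s t : T) : sval s = sval t -> s = t.
  by case: s t => [s Hs] [t Ht] /= st; subst t; congr exist; exact: Prop_irrelevance.
have geNp (t : T) x : - p (- x) <= sval t x.
  have [st tp] := svalP t.
  by apply: le_trans (sublinear_geN x st); rewrite lerN2.
have [||s t st ts|A totA|[q [sq qp]] qmin] := @Zorn T below.
- by move=> t; apply/asboolP.
- move=> r s t /asboolP rs /asboolP st; apply/asboolP => x.
  exact: le_trans (st x) (rs x).
- apply: svalI; apply/funext => x; apply/eqP; rewrite eq_le.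
  by move/asboolP : st => ->; move/asboolP : ts => ->.
- have [[t0 At0]|/set0P/negP/negPn/eqP A0] := pselect (A !=set0); last first.
    have sp' : sublinear p /\ forall x, p x <= p x by [].
    by exists (exist _ p sp') => s; rewrite A0.
  pose q x := inf [set sval t x | t in A].
  have q_le (t : T) x : A t -> q x <= sval t x.
    move=> At; apply: ge_inf; last by exists t.
    by exists (- p (- x)) => _ [s _ <-].
  have q_ge x c : (forall t, A t -> c <= sval t x) -> c <= q x.
    move=> cA; apply: lb_le_inf; first by exists (sval t0 x), t0.
    by move=> _ [t At <-]; exact: cA.
  have sq : sublinear q.
    split=> [u v|a u a0].
      rewrite -lerBlDr; apply: (q_ge) => s As; rewrite lerBlDl -lerBlDr.
      apply: (q_ge) => t At; rewrite lerBlDr.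
      (* Members of the chain are comparable, so s u + t v is bounded below through the smaller of
         the two, here t, whose subadditivity applies. *)
      wlog st : s t As At u v / below s t.
        move=> wl; have [|] := totA s t As At; first exact: wl.
        by rewrite addrC [leRHS]addrC; apply: wl.
      have [[tD _] _] := svalP t.
      apply: le_trans (q_le t _ At) _; apply: le_trans (tD _ _) _.
      by rewrite addrC lerD2l; move/asboolP : st; apply.
    have := a0; rewrite le_eqVlt => /predU1P[<-|a_gt0].
      rewrite scale0r mul0r; apply/eqP; rewrite eq_le; apply/andP; split.
        by have [st _] := svalP t0; rewrite -(sublinear0 st) q_le.
      by apply: (q_ge) => t At; have [st _] := svalP t; rewrite (sublinear0 st).
    apply/eqP; rewrite eq_le; apply/andP; split.
      rewrite mulrC -ler_pdivrMr//; apply: (q_ge) => t At; rewrite ler_pdivrMr//.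
      by have [[_ tZ] _] := svalP t; rewrite mulrC -tZ// q_le.
    apply: (q_ge) => t At; have [[_ tZ] _] := svalP t.
    by rewrite tZ// ler_wpM2l// q_le.
  have qp x : q x <= p x.
    by have [_ tp] := svalP t0; exact: le_trans (q_le _ _ At0) (tp x).
  exists (exist _ q (conj sq qp)) => s As; apply/asboolP => x /=.
  exact: q_le.
- exists q; split=> // q' sq' q'q.
  have sq'p : sublinear q' /\ forall x, q' x <= p x.
    by split=> // x; exact: le_trans (q'q x) (qp x).
  have /(_ _)/(congr1 sval) := qmin (exist _ q' sq'p); apply.
  exact/asboolP.
Qed.

(** A minimal sublinear q is odd: lowering it by the ray through (v, q v) must give q back, whence q
    (- v) <= - q v. Odd and sublinear means linear. *)
Lemma sublinear_ge_linear p : sublinear p ->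
  exists2 g : V -> R, linear g & forall x, g x <= p x.
Proof.
move=> /minimal_sublinear[q [sq qp qmin]]; exists q => //.
have [qD qZ] := sq.
have qN v : q (- v) = - q v.
  pose C := [set s | exists2 a : R, 0 <= a & s = (a *: v, a * q v)].
  have cC : convex_cone C.
    split=> [|_ _ [a a0 ->] [b b0 ->]|a _ a0 [b b0 ->]].
    - by exists 0 => //; rewrite scale0r mul0r.
    - by exists (a + b); rewrite ?addr_ge0//= scalerDl mulrDl.
    - by exists (a * b); rewrite ?mulr_ge0//= scalerA mulrA.
  have Cq s : C s -> s.2 <= q s.1 by move=> [a a0 ->] /=; rewrite qZ.
  have CqE : lower_by q C = q.
    by apply: qmin; [exact: sublinear_lower_by|exact: lower_by_le].
  apply/eqP; rewrite eq_le; apply/andP; split.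
    have Cv : C (v, q v) by exists 1; rewrite ?scale1r ?mul1r.
    by have := lower_by_opp sq Cq Cv; rewrite CqE.
  by rewrite lerNl; apply: sublinear_geN.
have qD' u v : q (u + v) = q u + q v.
  apply/eqP; rewrite eq_le qD /= -[u + v]opprK opprD qN lerNr opprD -!qN.
  exact: qD.
move=> a u v; rewrite qD'; congr (_ + _).
have [a0|a0] := leP 0 a; first exact: qZ.
rewrite -[a]opprK scaleNr qN qZ ?oppr_ge0; last exact: ltW.
by rewrite -mulNr opprK.
Qed.

(** A linear g below p lowered by a cone C satisfies t <= g z for all (z, t) in C. With C generated
    by M * {0} and (x0, c), this gives c <= g x0 and g >= 0 on M, hence g = 0 on M because M = -
    M. *)
Lemma real_hahn_banach p (M : set V) x0 c :
  sublinear p -> (forall x, 0 <= p x) -> M 0 -> (forall a u v, M u -> M v -> M (a *: u + v)) -> 0 <= c ->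
  (forall y, M y -> c <= p (x0 + y)) ->
  exists g : V -> R, [/\ linear g, forall x, g x <= p x,
    forall y, M y -> g y = 0 & c <= g x0].
Proof.
move=> sp p0 M0 Mlin c0 cp; have [pD pZ] := sp.
have MZ a u : M u -> M (a *: u) by move=> Mu; rewrite -[_ *: _]addr0; exact: Mlin.
pose C := [set s | exists2 t : V * R, M t.1 /\ 0 <= t.2 &
  s = (t.1 + t.2 *: x0, t.2 * c)].
have cC : convex_cone C.
  split=> [|_ _ [[y a] /= [My a0] ->] [[z b] [/= Mz b0] ->]|b _ b0 [[y a] /= [My a0] ->]] /=.
  - by exists (0, 0); rewrite //= scale0r addr0 mul0r.
  - exists (y + z, a + b) => /=.
      by rewrite addr_ge0//; split=> //; rewrite -[y]scale1r; exact: Mlin.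
    by rewrite scalerDl mulrDl addrACA.
  - exists (b *: y, b * a) => /=; first by rewrite mulr_ge0//; split=> //; exact: MZ.
    by rewrite scalerDr scalerA mulrA.
have Cp s : C s -> s.2 <= p s.1.
  move=> [[y a] /= [My a0] ->] /=.
  have := a0; rewrite le_eqVlt => /predU1P[<-|a_gt0]; first by rewrite mul0r.
  have := cp _ (MZ a^-1 _ My); rewrite -(ler_pM2l a_gt0) -(pZ _ _ a0) scalerDr scalerA.
  by rewrite divff ?gt_eqF// scale1r mulrC addrC.
have [g lg gq] := sublinear_ge_linear (sublinear_lower_by sp cC Cp).
have gN v : g (- v) = - g v.
  have := lg (-1) v 0.
  have g0 : g 0 = 0.
    have := lg 1 0 0; rewrite scaler0 addr0 scale1r => /eqP.
    by rewrite -subr_eq0 opprD addrA subrr sub0r oppr_eq0 => /eqP.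
  by rewrite g0 !addr0 !scaleN1r.
have gC s : C s -> s.2 <= g s.1.
  by move=> Cs; rewrite -[g _]opprK lerNr -gN; apply: le_trans (gq _) _; exact: lower_by_opp.
have gM y : M y -> 0 <= g y.
  move=> My; have : C (y, 0) by exists (y, 0); rewrite //= scale0r addr0 mul0r.
  by move/gC.
exists g; split=> //.
- by move=> x; apply: le_trans (gq x) _; exact: lower_by_le.
- move=> y My; apply/eqP; rewrite eq_le gM// andbT -oppr_ge0 -gN.
  by apply: gM; rewrite -scaleN1r; exact: MZ.
- have : C (x0, c) by exists (0, 1); rewrite //= scale1r add0r mul1r.
  by move/gC.
Qed.

End real_hahn_banach.

(* A property of one field K, like sup_complete, compact_disc and geometric_null
   below, so that the rest of the argument treats R and R[i] at once. *)
Definition hahn_banach (K : numFieldType) : Prop :=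
  forall (V : lmodType K) (p : V -> K) (M : set V) (x0 : V) (c : K),
  (forall u v, p (u + v) <= p u + p v) ->
  (forall a u, p (a *: u) = `|a| * p u) ->
  (forall u, 0 <= p u) ->
  M 0 -> (forall a u v, M u -> M v -> M (a *: u + v)) ->
  0 <= c -> (forall y, M y -> c <= p (x0 + y)) ->
  exists g : V -> K^o, [/\ linear g, forall x, `|g x| <= p x,
    forall y, M y -> g y = 0 & c <= `|g x0|].

Section linear_maps.
Context {K : numFieldType} {V W : lmodType K} {f : V -> W}.
Hypothesis lf : linear f.

Lemma linear_fun0 : f 0 = 0.
Proof.
have := lf 1 0 0; rewrite scaler0 addr0 scale1r => /eqP.
by rewrite -subr_eq0 opprD addrA subrr sub0r oppr_eq0 => /eqP.
Qed.

Lemma linear_funZ a u : f (a *: u) = a *: f u.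
Proof. by have := lf a u 0; rewrite linear_fun0 !addr0. Qed.

Lemma linear_funD u v : f (u + v) = f u + f v.
Proof. by have := lf 1 u v; rewrite !scale1r. Qed.

Lemma linear_funN u : f (- u) = - f u.
Proof. by rewrite -scaleN1r linear_funZ scaleN1r. Qed.

Lemma linear_funB u v : f (u - v) = f u - f v.
Proof. by rewrite linear_funD linear_funN. Qed.

Lemma linear_fun_sum (I : Type) (r : seq I) (P : pred I) (x : I -> V) :
  f (\sum_(i <- r | P i) x i) = \sum_(i <- r | P i) f (x i).
Proof.
elim/big_rec2 : _ => [|i y z _ <-]; first exact: linear_fun0.
exact: linear_funD.
Qed.

End linear_maps.

Lemma hahn_banachR (R : realType) : hahn_banach R.
Proof.
move=> V p M x0 c pD pZ p0 M0 Mlin c0 cp.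
have sp : sublinear p by split=> // a u a0; rewrite pZ ger0_norm.
have [g [lg gp gM cg]] := real_hahn_banach sp p0 M0 Mlin c0 cp.
exists g; split=> // [x|]; last exact: le_trans cg (ler_norm _).
rewrite ler_norml gp andbT lerNl.
have <- : g (- x) = - g x by exact: (linear_funN (W := R^o) lg).
by apply: le_trans (gp _) _; rewrite -scaleN1r pZ normrN1 mul1r.
Qed.

(** * Complex Hahn-Banach by restriction of scalars *)

Section realification.
Context {R : realType} (V : lmodType R[i]).

(** A separate name for V, so that the real module structure does not clash with the complex one. *)
Definition realification : Type := V.

HB.instance Definition _ := GRing.Zmodule.on realification.

Let scale (a : R) (v : realification) : realification := (a%:C%C : R[i]) *: (v : V).

Let scaleA a b v : scale a (scale b v) = scale (a * b) v.
Proof. by rewrite /scale scalerA rmorphM. Qed.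
Let scale1 : left_id 1 scale.
Proof. by move=> v; rewrite /scale rmorph1 scale1r. Qed.
Let scaleDr : right_distributive scale +%R.
Proof. by move=> a u v; exact: scalerDr. Qed.
Let scaleDl v : {morph scale^~ v : a b / a + b}.
Proof. by move=> a b; rewrite /scale rmorphD scalerDl. Qed.

HB.instance Definition _ := GRing.Zmodule_isLmodule.Build R realification
  scaleA scale1 scaleDr scaleDl.

Lemma realification_scale (a : R) (v : realification) :
  a *: v = (a%:C%C : R[i]) *: (v : V).
Proof. by []. Qed.

End realification.

Section complex_facts.
Context {R : realType}.
Implicit Types z : R[i].

Lemma ge0_complexE z : 0 <= z -> z = ((complex.Re z)%:C)%C.
Proof. by case: z => a b; rewrite lecE /= => /andP[/eqP -> _]. Qed.

Lemma Re_ge0 z : 0 <= z -> 0 <= complex.Re z.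
Proof. by case: z => a b; rewrite lecE /= => /andP[]. Qed.

Lemma Re_le z t : z <= t -> complex.Re z <= complex.Re t.
Proof. by case: z => a b; case: t => c d; rewrite lecE /= => /andP[]. Qed.

Lemma ReD z t : complex.Re (z + t) = complex.Re z + complex.Re t.
Proof. by case: z => a b; case: t. Qed.

Lemma Re_le_norm z : ((complex.Re z)%:C)%C <= `|z|.
Proof.
by apply: le_trans (normc_ge_Re z); rewrite lecR; exact: ler_norm.
Qed.

End complex_facts.

(** A real functional h given by the real theorem is the real part of the complex-linear g u = h u -
    i h (i u). *)
Lemma hahn_banachC (R : realType) : hahn_banach R[i].
Proof.
move=> V p M x0 c pD pZ p0 M0 Mlin c0 cp.
pose W := realification V.
pose q (u : W) : R := complex.Re (p u).
have pE u : p u = ((q u)%:C)%C by exact: ge0_complexE.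
have sq : sublinear q.
  split=> [u v|a u a0]; first by rewrite /q -ReD; apply: Re_le; exact: pD.
  rewrite /q realification_scale pZ pE normc_def /= expr0n addr0 sqrtr_sqr ger0_norm//.
  by rewrite /= mulr0 subr0.
have MlinW (a : R) (u v : W) : M u -> M v -> M (a *: u + v).
  exact: Mlin.
have [|||h [lh hq hM ch]] := @real_hahn_banach R W q M x0 (complex.Re c) sq _ M0 MlinW.
- by move=> x; exact: Re_ge0.
- exact: Re_ge0.
- by move=> y /cp/Re_le.
have hD u v : h (u + v) = h u + h v by exact: (linear_funD (W := R^o) lh).
have hZ (a : R) (u : W) : h (a *: u) = a * h u by exact: (linear_funZ (W := R^o) lh).
have hZC (a : R) (u : V) : h ((a%:C)%C *: u) = a * h u by exact: hZ.
have hN (u : V) : h (- u) = - h u by exact: (linear_funN (W := R^o) lh).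
pose g (u : V) : R[i] := Complex (h u) (- h ('i%C *: u)).
have gD u v : g (u + v) = g u + g v.
  by rewrite /g scalerDr !hD opprD.
have gZ a u : g (a *: u) = a * g u.
  case: a => a b; set z := Complex a b.
  have zE : z = a%:C%C + 'i%C * b%:C%C by exact: complexE.
  have h1 : h (z *: u) = a * h u + b * h ('i%C *: u).
    by rewrite zE scalerDl hD hZC ['i%C * _]mulrC -scalerA hZC.
  have h2 : h ('i%C *: (z *: u)) = a * h ('i%C *: u) - b * h u.
    rewrite scalerA zE mulrDr scalerDl hD.
    rewrite [_ * a%:C%C]mulrC -(scalerA a%:C%C) hZC.
    by rewrite mulrA -expr2 sqr_i mulN1r scaleNr hN hZC.
  rewrite /g h1 h2 -[RHS]/(Complex (a * h u - b * - h ('i%C *: u))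
    (a * - h ('i%C *: u) + b * h u)).
  by congr Complex; ring.
exists g; split.
- by move=> a u v; rewrite gD gZ.
- move=> x.
  have [->|gx0] := eqVneq (g x) 0; first by rewrite normr0.
  (* A rotation with g (t *: x) = |g x|: this value is real, so it equals h (t *: x), which is at
     most p (t *: x) = p x. *)
  pose t := `|g x| / g x.
  have gt : g (t *: x) = `|g x| by rewrite gZ /t divfK.
  have -> : `|g x| = ((complex.Re (g (t *: x)))%:C)%C.
    by rewrite gt; exact: ge0_complexE.
  have -> : p x = ((q (t *: x))%:C)%C.
    by rewrite -pE pZ /t normrM normfV normr_id mulfV ?mul1r// normr_eq0.
  by rewrite lecR; exact: (hq (t *: x : V)).
- move=> y My; rewrite /g !hM ?oppr0//.
  by rewrite -[_ *: _]addr0; exact: Mlin.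
- rewrite (ge0_complexE c0); apply: le_trans (Re_le_norm (g x0)).
  by rewrite lecR.
Qed.

(** * The scalar fields *)

(** Restricted to nonnegative elements, which even in R[i] are real and so totally ordered; it is
    applied to sets of norms. *)
Definition sup_complete (K : numFieldType) : Prop :=
  forall A : set K, A !=set0 -> (forall x, A x -> 0 <= x) -> has_ubound A ->
  supremums A !=set0.

Definition compact_disc (K : numFieldType) : Prop :=
  compact [set t : K^o | `|t| <= 1].

(** The Archimedean property, in the form suited to errors that are halved at each step. *)
Definition geometric_null (K : numFieldType) : Prop :=
  forall e : K, 0 < e -> exists n, 2^-1 ^+ n < e.

Lemma sup_completeR (R : realType) : sup_complete R.
Proof.
move=> A A0 _ uA; exists (sup A); split; first exact: ub_le_sup.
by move=> y Ay; apply: sup_le_ub.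
Qed.

Lemma compact_discR (R : realType) : compact_disc R.
Proof.
rewrite /compact_disc (_ : [set t : R^o | `|t| <= 1] = `[-1, 1]%classic).
  exact: segment_compact.
by apply/seteqP; split=> x /=; rewrite in_itv/= ler_norml.
Qed.

Lemma geometric_nullR (R : realType) : geometric_null R.
Proof.
move=> e e0.
have h : `|2^-1 : R| < 1 by rewrite ger0_norm ?invr_ge0// invf_lt1// ltr1n.
have /cvgrPdist_lt/(_ e e0)[n _ /(_ n (leqnn n))] := cvg_expr h.
by rewrite sub0r normrN ger0_norm ?exprn_ge0 ?invr_ge0// => ?; exists n.
Qed.

Lemma sup_completeC (R : realType) : sup_complete R[i].
Proof.
move=> A [x0 Ax0] A0 [b ub].
pose B := [set complex.Re x | x in A].
have uB : has_ubound B.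
  by exists (complex.Re b) => _ [x Ax <-]; apply: Re_le; exact: ub.
exists ((sup B)%:C)%C; split.
  move=> x Ax; rewrite (ge0_complexE (A0 _ Ax)) lecR.
  by apply: ub_le_sup => //; exists x.
move=> y uy; have y0 : 0 <= y by exact: le_trans (A0 _ Ax0) (uy _ Ax0).
rewrite (ge0_complexE y0) lecR; apply: sup_le_ub; first by exists (complex.Re x0), x0.
by move=> _ [x Ax <-]; apply: Re_le; exact: uy.
Qed.

Lemma gt0_complex (R : realType) (e : R[i]) : 0 < e ->
  exists2 r : R, 0 < r & e = (r%:C)%C.
Proof.
move=> e0; exists (complex.Re e); last exact: ge0_complexE (ltW e0).
by rewrite -ltcR -ge0_complexE// ltW.
Qed.

Lemma geometric_nullC (R : realType) : geometric_null R[i].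
Proof.
move=> e /gt0_complex[r r0 ->]; have [n nr] := geometric_nullR r0.
by exists n; rewrite -ltcR rmorphXn fmorphV rmorph_nat in nr.
Qed.

Lemma continuous_complex (R : realType) :
  continuous (fun z : R * R => Complex z.1 z.2 : R[i]^o).
Proof.
move=> [a b]; apply/cvgrPdist_lt => e /gt0_complex[r r0 ->].
have r2 : 0 < r / 2 by rewrite divr_gt0.
exists ([set x | `|a - x| < r / 2], [set x | `|b - x| < r / 2]) => /=.
  by split; [exact: (@nbhsx_ballx R R a)|exact: (@nbhsx_ballx R R b)].
move=> [x y] /= [ax by_].
rewrite (_ : Complex a b - Complex x y = Complex (a - x) (b - y))//.
rewrite normc_def /= ltcR.
apply: (@le_lt_trans _ _ (`|a - x| + `|b - y|)); last lra.
rewrite -(@ler_pXn2r _ 2%N) ?nnegrE ?sqrtr_ge0 ?addr_ge0// sqr_sqrtr ?addr_ge0 ?sqr_ge0//.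
rewrite [leRHS]sqrrD !real_normK ?num_real// addrAC lerDl.
by rewrite mulrn_wge0// mulr_ge0.
Qed.

Lemma closed_norm_le (K : numFieldType) (V : normedModType K) (c : K) :
  0 <= c -> closed [set v : V | `|v| <= c].
Proof.
move=> c0 x xc /=; rewrite real_leNgt ?ger0_real//; apply/negP => cx.
have xc0 : 0 < `|x| - c by rewrite subr_gt0.
have [y [/= yc]] := xc _ (nbhsx_ballx x _ xc0).
rewrite -ball_normE /= => xy; have := ler_normD y (x - y).
rewrite addrC subrK => /le_lt_trans/(_ (ler_ltD yc xy)).
by rewrite addrC subrK ltxx.
Qed.

(** The disc is a closed subset of the continuous image of the compact square [-1, 1]^2. *)
Lemma compact_discC (R : realType) : compact_disc R[i].
Proof.
pose Q : set (R * R) := `[-1, 1]%classic `*` `[-1, 1]%classic.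
have cQ : compact ((fun z : R * R => Complex z.1 z.2 : R[i]^o) @` Q).
  apply: continuous_compact; first exact/continuous_subspaceT/continuous_complex.
  by apply: compact_setX; exact: segment_compact.
apply: (subclosed_compact _ cQ).
  exact: (@closed_norm_le _ R[i]^o).
move=> [a b] ab; exists (a, b) => //=.
move: ab; rewrite /= normc_def /= -(rmorph1 (real_complex R)) lecR.
move=> ab1.
have : a ^+ 2 + b ^+ 2 <= 1.
  by rewrite -(@sqr_sqrtr _ (_ + _)) ?addr_ge0 ?sqr_ge0// expr_le1// sqrtr_ge0.
move=> h; have := sqr_ge0 a; have := sqr_ge0 b => b0 a0.
rewrite /Q /= !in_itv /= -!ler_norml.
by split; rewrite -(@expr_le1 _ 2%N)// real_normK ?num_real//; lra.
Qed.

(** * The dual and its l1-basis *)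

Section operator_norm.
Context {K : numFieldType} (supK : sup_complete K).
Context {X Z : normedModType K}.
Implicit Types T : X -> Z.

Lemma bounded_opsP T :
  bounded_ops T <-> linear T /\ exists M, forall x, `|x| <= 1 -> `|T x| <= M.
Proof.
split=> [[lT [M [Mr TM]]]|[lT [M TM]]]; split=> //.
  by exists (M + 1) => x x1; apply: (TM (M + 1)) => //; rewrite ltrDl.
exists M; split=> [|N MN x x1]; last exact: le_trans (TM _ x1) (ltW MN).
have := TM 0; rewrite normr0 ler01 => /(_ isT) h.
by rewrite ger0_real//; exact: le_trans h.
Qed.

(** [supremum] returns its default 0 when the set is empty or has no least upper bound; |T 0| rules
    out the first case, M and [supK] the second. *)
Lemma opnorm_supremums T M : (forall x, `|x| <= 1 -> `|T x| <= M) ->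
  supremums [set `|T x| | x in @unit_ball K X] (opnorm T).
Proof.
move=> TM; rewrite /opnorm /supremum.
have A0 : [set `|T x| | x in @unit_ball K X] !=set0.
  by exists `|T 0|, 0 => //; rewrite /unit_ball /= normr0 ler01.
rewrite ifF; last by apply/negbTE/set0P.
have [||y /xgetI] := supK A0; last exact.
- by move=> _ [x _ <-].
- by exists M => _ [x x1 <-]; exact: TM.
Qed.

Lemma opnorm_le T M : (forall x, `|x| <= 1 -> `|T x| <= M) -> opnorm T <= M.
Proof.
move=> TM; have [_] := opnorm_supremums TM; apply=> _ [x x1 <-]; exact: TM.
Qed.

Lemma le_opnorm1 T x : bounded_ops T -> `|x| <= 1 -> `|T x| <= opnorm T.
Proof.
move=> /bounded_opsP[lT [M TM]] x1.
by have [+ _] := opnorm_supremums TM; apply; exists x.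
Qed.

Lemma opnorm_ge0 T : bounded_ops T -> 0 <= opnorm T.
Proof.
by move=> bT; apply: le_trans (@le_opnorm1 T 0 bT _); rewrite // normr0 ler01.
Qed.

Lemma le_opnorm T x : bounded_ops T -> `|T x| <= opnorm T * `|x|.
Proof.
move=> bT; have [lT _] := bT.
have [->|x0] := eqVneq x 0; first by rewrite linear_fun0// !normr0 mulr0.
have nx0 : 0 < `|x| by rewrite normr_gt0.
rewrite -ler_pdivrMr// -[in leLHS](normr_id x) -normfV mulrC -normrZ.
rewrite -linear_funZ//; apply: le_opnorm1 => //.
by rewrite normrZ normfV normr_id mulVf ?gt_eqF.
Qed.

Lemma bounded_ops_lin a T1 T2 : bounded_ops T1 -> bounded_ops T2 ->
  bounded_ops (a *: T1 + T2).
Proof.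
move=> b1 b2; have [l1 _] := b1; have [l2 _] := b2.
apply/bounded_opsP; split=> [b u v|].
  rewrite !fctE l1 l2 !scalerDr !scalerA [a * b]mulrC -!addrA; congr (_ + _).
  by rewrite addrCA.
exists (`|a| * opnorm T1 + opnorm T2) => x x1.
rewrite !fctE; apply: le_trans (ler_normD _ _) _; rewrite normrZ.
by rewrite lerD ?ler_wpM2l ?le_opnorm1.
Qed.

End operator_norm.

Section ell1_tails.
Context {K : numFieldType}.
Implicit Types u : nat -> K^o.

Lemma normed_seriesE u n : [normed series u] n = \sum_(0 <= i < n) `|u i| :> K.
Proof. by []. Qed.

Lemma series_drop u n N : (n <= N)%N ->
  [normed series (fun m => if (m < n)%N then 0 else u m)] N =
  [normed series u] N - \sum_(i < n) `|u i|.
Proof.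
move=> nN; rewrite -(big_mkord xpredT (fun i => `|u i|)) !normed_seriesE.
rewrite !(big_cat_nat (leq0n n) nN) /=.
rewrite [X in _ = X - _]addrC addrK [X in X + _]big1_seq ?add0r.
  by apply: eq_big_nat => i /andP[ni _]; rewrite ltnNge ni.
by move=> i; rewrite mem_index_iota => /andP[_ /andP[_ ->]]; rewrite normr0.
Qed.

(** Additivity of the l1-norm over disjoint supports, the only feature of this norm that the
    coordinates of the dual inherit besides the vanishing of tails. *)
Lemma ell1_drop u n : ell1 u -> let v m := if (m < n)%N then 0 else u m in
  ell1 v /\ ell1_norm u = \sum_(i < n) `|u i| + ell1_norm v.
Proof.
move=> cu v.
have vl : [normed series v] @ \oo --> (ell1_norm u - \sum_(i < n) `|u i| : K^o).
  apply: cvg_trans (cvgB cu (cvg_cst (\sum_(i < n) `|u i| : K^o))).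
  apply: near_eq_cvg; near=> N; rewrite !fctE series_drop//.
  by near: N; exact: nbhs_infty_ge.
split; first exact: cvgP vl.
by rewrite /ell1_norm (cvg_lim _ vl)//= addrC subrK.
Unshelve. all: end_near. Qed.

Lemma ell1_tail u e : ell1 u -> 0 < e ->
  exists n, forall m, (n <= m)%N -> `|ell1_norm u - \sum_(i < m) `|u i| | < e.
Proof.
move=> cu e0; have /cvgrPdist_lt/(_ e e0)[n _ h] := cu.
by exists n => m nm; have := h m nm; rewrite normed_seriesE big_mkord.
Qed.

Lemma ell1_delta n : ell1 (fun m => (m == n)%:R : K^o) /\
  ell1_norm (fun m => (m == n)%:R : K^o) = 1.
Proof.
have dl : [normed series (fun m => (m == n)%:R : K^o)] @ \oo --> (1 : K^o).
  apply: cvg_trans (cvg_cst (1 : K^o)).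
  apply: near_eq_cvg; near=> N.
  rewrite normed_seriesE (bigD1_seq n) ?iota_uniq//=; last first.
    rewrite mem_index_iota /=; near: N; exact: nbhs_infty_gt.
  rewrite eqxx normr1 big1 ?addr0// => i /negbTE ->; exact: normr0.
  exact: eventually_filter.
by split; [exact: cvgP dl|exact: cvg_lim dl].
Unshelve. all: end_near. Qed.

End ell1_tails.

Section dual_basis.
Context {K : numFieldType} (supK : sup_complete K) {X : normedModType K}.

(* a f is the coordinate sequence of f in the l1-basis e of the dual. *)
Definition ell1_coordinates (a : (X -> K^o) -> nat -> K) (e : nat -> X -> K^o) :=
  [/\ forall m, dual (e m) /\ (forall x, `|e m x| <= `|x|),
      forall m k, a (e m) k = (k == m)%:R,
      forall b f g, dual f -> dual g -> forall m, a (b *: f + g) m = b * a f m + a g m,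
      forall f n, dual f -> opnorm f =
        \sum_(i < n) `|a f i| + opnorm (f - \sum_(i < n) a f i *: e i) &
      forall f, dual f -> forall eps, 0 < eps -> exists n, forall m, (n <= m)%N ->
        opnorm (f - \sum_(i < m) a f i *: e i) < eps].

(** The coordinates are given by the isometry itself, and [e m] is the preimage of the m-th unit
    sequence. Subtracting the first n terms from f zeroes its first n coordinates, so [ell1_drop]
    and [ell1_tail] carry over to operator norms. *)
Lemma dual_ell1_coordinates : dual_is_ell1 X -> exists a e, ell1_coordinates a e.
Proof.
move=> [Phi [Phil [Phif _ Phis] Phin]].
have /choice[e eP] : forall m, exists f, dual f /\ Phi f = (fun k => (k == m)%:R).
  move=> m; have [f df <-] := Phis _ (ell1_delta m).1.
  by exists f.
have Pl b f g m : dual f -> dual g -> Phi (b *: f + g) m = b * Phi f m + Phi g m.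
  by move=> df dg; rewrite Phil.
pose r f n := f - \sum_(i < n) Phi f i *: e i.
(* [Phi] is linear only on the dual, so terms are removed one at a time, each step having the form b
   *: f + g. *)
have rS f n : r f n.+1 = (- Phi f n) *: e n + r f n.
  by rewrite /r big_ord_recr /= opprD addrA scaleNr addrC.
have rP f n : dual f -> dual (r f n) /\
    Phi (r f n) = fun m => if (m < n)%N then 0 else Phi f m.
  move=> df; elim: n => [|n [dr rE]].
    by rewrite /r big_ord0 subr0.
  have [de eE] := eP n.
  rewrite rS; split; first exact: bounded_ops_lin.
  apply/funext => m; rewrite Pl// rE eE [in RHS]ltnS [in RHS]leq_eqVlt.
  have [->|mn] := eqVneq m n; first by rewrite ltnn mulr1 addNr.
  by rewrite mulr0 add0r.
have rN f n : dual f -> opnorm f = \sum_(i < n) `|Phi f i| + opnorm (r f n).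
  move=> df; have [dr rE] := rP f n df.
  rewrite -(Phin _ df) -(Phin _ dr) rE.
  by have [_ ->] := ell1_drop n (Phif _ df).
exists Phi, e; split=> //.
- move=> m; have [de eE] := eP m; split=> // x.
  apply: le_trans (le_opnorm supK x de) _.
  by rewrite -(Phin _ de) eE (ell1_delta m).2 mul1r.
- by move=> m k; rewrite (eP m).2.
- by move=> b f g df dg m; rewrite Pl.
- move=> f df eps eps0; have [n h] := ell1_tail (Phif _ df) eps0.
  exists n => m nm; have := h m nm.
  rewrite (Phin _ df) (rN f m df) addrC addKr ger0_norm//.
  by apply: opnorm_ge0 => //; have [] := rP f m df.
Qed.

End dual_basis.

(** * Lifting from finitely many coordinates *)

Lemma normD_rotate (K : numFieldType) (z w : K) :
  exists2 t : K, `|t| = 1 & `|t * z + w| = `|z| + `|w|.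
Proof.
have [->|z0] := eqVneq z 0.
  by exists 1; rewrite ?normr1// mulr0 normr0 !add0r.
have nz : `|z| != 0 by rewrite normr_eq0.
have [->|w0] := eqVneq w 0.
  by exists 1; rewrite ?normr1// mul1r normr0 !addr0.
have nw : `|w| != 0 by rewrite normr_eq0.
(* The phase of w times the inverse phase of z aligns the two summands. *)
exists ((w / `|w|) * (`|z| / z)).
  by rewrite !normrM !normfV !normr_id !mulfV// mul1r.
have -> : w / `|w| * (`|z| / z) * z + w = (w / `|w|) * (`|z| + `|w|).
  by rewrite mulrDr !mulrA !divfK.
by rewrite normrM normrM normfV normr_id mulfV// mul1r ger0_norm// addr_ge0.
Qed.

Section ell1_predual.
Context {K : numFieldType} (hbK : hahn_banach K) (supK : sup_complete K).
Context {X : normedModType K} {a : (X -> K^o) -> nat -> K} {e : nat -> X -> K^o}.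
Hypothesis ae : ell1_coordinates a e.
Implicit Types f g : X -> K^o.

Let e_dual m : dual (e m). Proof. by have [/(_ m)[]] := ae. Qed.
Let e_lin m : linear (e m). Proof. by have [] := e_dual m. Qed.

Definition rest f n := f - \sum_(i < n) a f i *: e i.

Lemma restS f n : rest f n.+1 = (- a f n) *: e n + rest f n.
Proof. by rewrite /rest big_ord_recr /= opprD addrA scaleNr addrC. Qed.

Lemma rest_dual f n : dual f -> dual (rest f n).
Proof.
move=> df; elim: n => [|n ih]; first by rewrite /rest big_ord0 subr0.
by rewrite restS; exact: (bounded_ops_lin supK _ (e_dual n) ih).
Qed.

Lemma restE f n x : f x = \sum_(i < n) a f i * e i x + rest f n x.
Proof.
have -> : \sum_(i < n) a f i * e i x = (\sum_(i < n) a f i *: e i) x.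
  by rewrite fct_sumE.
by rewrite /rest; set S := \sum_(i < n) _; rewrite [RHS]addrC -[f x](subrK (S x)).
Qed.

Lemma opnorm_rest f n : dual f ->
  opnorm f = \sum_(i < n) `|a f i| + opnorm (rest f n).
Proof. by have [_ _ _ + _] := ae; apply. Qed.

Lemma coord_le f m : dual f -> `|a f m| <= opnorm f.
Proof.
move=> df; rewrite (opnorm_rest m.+1)// big_ord_recr /= -addrA addrCA lerDl.
by rewrite addr_ge0 ?sumr_ge0 ?opnorm_ge0//; exact: rest_dual.
Qed.

Lemma opnorm_rest_le f n : dual f -> opnorm (rest f n) <= opnorm f.
Proof. by move=> df; rewrite [leRHS](opnorm_rest n)// lerDr sumr_ge0. Qed.

Lemma coord_lin b f g m : dual f -> dual g -> a (b *: f + g) m = b * a f m + a g m.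
Proof. by move=> df dg; have [_ _ + _ _] := ae; apply. Qed.

Definition ker n : set X := [set x | forall i, (i < n)%N -> e i x = 0].

Lemma kerS n x : ker n x -> e n x = 0 -> ker n.+1 x.
Proof. by move=> nx ex i; rewrite ltnS leq_eqVlt => /predU1P[->//|]; exact: nx. Qed.

Lemma ker_lin n b x y : ker n x -> ker n y -> ker n (b *: x + y).
Proof. by move=> nx ny i im; rewrite e_lin nx// ny// scaler0 addr0. Qed.

Lemma ker0 n : ker n 0.
Proof. by move=> i _; rewrite linear_fun0. Qed.

(** By induction on n. If e n is nonzero at some v in [ker n], a multiple of e n added to f makes it
    vanish on all of [ker n] and leaves the coordinates beyond n unchanged. If there is no such v,
    the induction hypothesis for e n itself contradicts a (e n) n = 1. *)
Lemma ker_coord n f : dual f -> (forall x, ker n x -> f x = 0) ->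
  forall m, (n <= m)%N -> a f m = 0.
Proof.
elim: n f => [|n ih] f df f0 m nm.
  apply/eqP; rewrite -normr_le0; apply: le_trans (coord_le m df) _.
  by apply: opnorm_le => // x _; rewrite f0 ?normr0.
have [[v [nv ev]]|nov] := pselect (exists v, ker n v /\ e n v != 0); last first.
  have : a (e n) n = 0.
    apply: (ih _ (e_dual n)) => // x nx; apply/eqP/negP => ex.
    by apply: nov; exists x; split=> //; exact/negP.
  by have [_ -> _ _ _] := ae; rewrite eqxx => /eqP; rewrite oner_eq0.
pose b := - (f v / e n v); pose g := b *: e n + f.
have dg : dual g by exact: (bounded_ops_lin supK _ (e_dual n) df).
have g0 x : ker n x -> g x = 0.
  move=> nx; have [lf _] := df.
  (* Moving x along v brings it into the kernel of e n; [b] is chosen so that f takes the value g x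
     at the moved point. *)
  have h : ker n.+1 (- (e n x / e n v) *: v + x).
    apply: kerS; first exact: ker_lin.
    by rewrite e_lin /GRing.scale /= mulNr divfK// addNr.
  rewrite -(f0 _ h) lf /g !fctE; congr (_ + _).
  by rewrite /b /GRing.scale /= !mulNr mulrC mulrA mulrAC.
have := ih g dg g0 m (ltnW nm); rewrite coord_lin//.
have [_ -> _ _ _] := ae.
by rewrite gtn_eqF// mulr0 add0r.
Qed.

(** If e n vanished on [ker n], its n-th coordinate would be 0 instead of 1. *)
Lemma ker_dual_vector n : exists2 v, ker n v & e n v = 1.
Proof.
apply: contrapT => nov.
have : a (e n) n = 0.
  apply: (@ker_coord n) => // x nx; apply/eqP/negP => /negP ex; apply: nov.
  exists ((e n x)^-1 *: x); first by rewrite -[_ *: _]addr0; apply: ker_lin => //; exact: ker0.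
  by rewrite linear_funZ// /GRing.scale /= mulVf.
by have [_ -> _ _ _] := ae; rewrite eqxx => /eqP; rewrite oner_eq0.
Qed.

Lemma interpolation (c : nat -> K) n : exists x, forall i, (i < n)%N -> e i x = c i.
Proof.
elim: n => [|n [x xc]]; first by exists 0.
have [v nv ev] := ker_dual_vector n.
exists ((c n - e n x) *: v + x) => i; rewrite ltnS leq_eqVlt e_lin => /predU1P[->|im].
  by rewrite ev /GRing.scale /= mulr1 subrK.
by rewrite nv// scaler0 add0r xc.
Qed.

(** All coordinates from n on vanish, so the remainders are constant from n on; as they tend to 0 in
    norm, they are 0. *)
Lemma ker_rest n f x : dual f -> (forall x, ker n x -> f x = 0) -> rest f n x = 0.
Proof.
move=> df f0; have af := ker_coord df f0.
suff r0 : opnorm (rest f n) = 0.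
  apply/eqP; rewrite -normr_le0.
  by apply: le_trans (le_opnorm supK x (rest_dual n df)) _; rewrite r0 mul0r.
apply/eqP/negP => /negP r0.
have r1 : 0 < opnorm (rest f n).
  by rewrite lt0r r0 opnorm_ge0//; exact: rest_dual.
have [_ _ _ _ /(_ f df _ r1)[m rm]] := ae.
have restE' k : rest f (n + k) = rest f n.
  elim: k => [|k ih]; first by rewrite addn0.
  by rewrite addnS restS ih af ?leq_addr// oppr0 scale0r add0r.
by have := rm _ (leq_addl n m); rewrite -/(rest f _) restE' ltxx.
Qed.

(** The excess d of |x0| over 1 is reduced to an arbitrary h at a cost proportional to d; this
    proportionality makes the iterated corrections summable. *)
Lemma correction n (c : nat -> K) x0 (d h : K) :
  (forall i, (i < n)%N -> `|c i| <= 1) ->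
  (forall i, (i < n)%N -> e i x0 = c i) ->
  0 < d -> 0 < h -> `|x0| <= 1 + d ->
  exists y, [/\ ker n y, `|y| <= d * (1 + h) & `|x0 + y| <= 1 + h].
Proof.
move=> c1 x0c d0 h0 x0d; apply: contrapT => noy.
(* The norm of a product is the maximum, so the factor d^-1 produces the weight d on the first
   component of a functional. *)
pose p (w : X * X) : K := `|(d^-1 *: w.1, w.2)|.
pose M : set (X * X) := [set (y, y) | y in ker n].
have pM w : M w -> 1 + h <= p ((0, x0) + w).
  move=> [y ny <-]; rewrite /p /= add0r prod_normE /= comparable_le_max; last first.
    by apply: real_comparable.
  rewrite !real_leNgt ?realD ?ger0_real// ?ltW// -negb_and.
  apply/negP => /andP[yd xy]; apply: noy; exists y; split=> //; last exact: ltW.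
  move: yd; rewrite normrZ normfV gtr0_norm// mulrC ltr_pdivrMr// => /ltW.
  by rewrite mulrC.
have [|||||||g [lg gp gM gx]] := hbK (p := p) (M := M) (x0 := (0, x0)) (c := 1 + h).
- move=> u v; rewrite /p /= scalerDr; exact: (ler_normD (_, _) (_, _)).
- move=> b u; rewrite /p /= -normrZ; congr (`| _ |).
  by congr pair; rewrite !scalerA mulrC.
- by move=> u; exact: normr_ge0.
- by exists 0 => //; exact: ker0.
- move=> b _ _ [y ny <-] [z nz <-]; exists (b *: y + z) => //; exact: ker_lin.
- by rewrite addr_ge0// ltW.
- exact: pM.
pose phi (x : X) : K^o := g (x, 0); pose psi (x : X) : K^o := g (0, x).
have gE u v : g (u, v) = phi u + psi v.
  by rewrite -(linear_funD lg) -[RHS]/(g (u + 0, 0 + v)) addr0 add0r.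
have lphi : linear phi.
  by move=> b u v; rewrite -lg; congr g; congr pair; rewrite /= scaler0 addr0.
have lpsi : linear psi.
  by move=> b u v; rewrite -lg; congr g; congr pair; rewrite /= scaler0 addr0.
have bound u v : `|u| <= 1 -> `|v| <= 1 -> d * `|phi u| + `|psi v| <= 1.
  (* Rotating u turns the bound on |g (u, v)| into a bound on the sum of the absolute values of both
     parts. *)
  move=> u1 v1; have [t t1 tE] := normD_rotate (d * phi u) (psi v).
  rewrite -[d in d * _]gtr0_norm// -normrM -tE.
  have -> : t * (d * phi u) + psi v = g ((t * d) *: u, v).
    by rewrite gE (linear_funZ lphi) /GRing.scale /= mulrA.
  apply: le_trans (gp _) _; rewrite /p prod_normE /= comparable_ge_max; last exact: real_comparable.
  by rewrite v1 andbT scalerA mulrCA mulVf ?gt_eqF// mulr1 normrZ t1 mul1r.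
have le01 : `|0 : X| <= 1 by rewrite normr0 ler01.
have dphi : dual phi.
  apply/bounded_opsP; split=> //; exists d^-1 => x x1.
  rewrite -div1r ler_pdivlMr// mulrC; apply: le_trans (bound x 0 x1 le01).
  by rewrite lerDl.
have dpsi : dual psi.
  apply/bounded_opsP; split=> //; exists 1 => x x1.
  by apply: le_trans (bound 0 x le01 x1); rewrite lerDr mulr_ge0// ltW.
have norms : opnorm psi + d * opnorm phi <= 1.
  rewrite -lerBrDl mulrC -ler_pdivlMr//; apply: opnorm_le => // u u1.
  rewrite ler_pdivlMr// lerBrDl -lerBrDr; apply: opnorm_le => // v v1.
  by rewrite lerBrDr addrC mulrC; exact: bound.
(* As phi + psi vanishes on [ker n], its remainder is 0, so the remainders of phi and psi are
   opposite. *)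
have rest_le : opnorm (rest psi n) <= opnorm phi.
  apply: le_trans (opnorm_rest_le n dphi); apply: opnorm_le => // x x1.
  have := @ker_rest n (1 *: phi + psi) x (bounded_ops_lin supK 1 dphi dpsi).
  have -> : rest (1 *: phi + psi) n x = rest phi n x + rest psi n x.
    rewrite /rest !fct_sumE !fctE scale1r addrACA -opprD -big_split /=; congr (_ - _).
    by apply: eq_bigr => i _; rewrite coord_lin// mul1r !fctE scalerDl.
  move=> hx; rewrite -normrN.
  have -> : - rest psi n x = rest phi n x.
    apply/eqP; rewrite eq_sym -subr_eq0 opprK; apply/eqP/hx => y ny.
    by rewrite !fctE scale1r -gE; apply: gM; exists y.
  by apply: le_opnorm1 => //; exact: rest_dual.
(* The first n coordinates contribute at most their l1-norm because |c i| <= 1. The remainder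
   contributes its norm times 1 + d, and the surplus is at most d * opnorm phi, which [norms]
   absorbs. *)
have : `|psi x0| <= 1.
  apply: le_trans norms; rewrite (opnorm_rest n dpsi) (restE psi n).
  apply: le_trans (ler_normD _ _) _; rewrite -addrA; apply: lerD.
    apply: le_trans (ler_norm_sum _ _ _) _; apply: ler_sum => i _.
    by rewrite normrM x0c// ler_piMr// c1.
  apply: le_trans (le_opnorm supK x0 (rest_dual n dpsi)) _.
  apply: (@le_trans _ _ (opnorm (rest psi n) * (1 + d))).
    by rewrite ler_wpM2l// opnorm_ge0//; exact: rest_dual.
  by rewrite mulrDr mulr1 lerD2l mulrC ler_wpM2l// ltW.
move=> /(le_trans gx); rewrite gerDl => /(lt_le_trans h0).
by rewrite ltxx.
Qed.

End ell1_predual.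

Arguments ker {K X} e n.

(** * Norms on compact sets, polydisc images and norming functionals *)

Section compactness.
Context {K : numFieldType} (supK : sup_complete K) {Z : normedModType K}.

Lemma compact_norm_bounded (A : set Z) : compact A ->
  exists M, forall w, A w -> `|w| <= M.
Proof.
rewrite compact_cover => cA.
have [||D' _ AD'] := cA Z setT (fun w => ball w 1).
- by move=> w _; exact: ball_open.
- by move=> w _; exists w => //; exact: ballxx.
(* A sum of nonnegative bounds dominates each of them without a maximum in a partially ordered
   field. *)
exists (\sum_(w <- finmap.enum_fset D') (`|w| + 1)) => w /AD'[v /= vD'].
rewrite -ball_normE /= => vw; rewrite (big_rem v)//=.
apply: (@le_trans _ _ (`|v| + 1)); last by rewrite lerDl sumr_ge0.
have := ler_normD v (w - v); rewrite addrC subrK => /le_trans; apply.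
by rewrite lerD2l distrC ltW.
Qed.

(** The supremum s of the norms lies in the closure of the compact set of norms: if a ball of radius
    d around s missed it, s - d would be a smaller upper bound. *)
Lemma compact_norm_max (A : set Z) : compact A -> A !=set0 ->
  exists2 w, A w & forall v, A v -> `|v| <= `|w|.
Proof.
move=> cA [w0 Aw0]; have [M AM] := compact_norm_bounded cA.
pose B : set K^o := [set `|w| | w in A].
have cB : compact B.
  apply: continuous_compact => //; apply: continuous_subspaceT.
  exact: norm_continuous.
have [|||s [us ls]] := supK (A := B).
- by exists `|w0|, w0.
- by move=> _ [w _ <-].
- by exists M => _ [w /AM + <-].
have s0 : 0 <= s by apply: le_trans (normr_ge0 w0) _; apply: us; exists w0.
have [w Aw sw] : B s; last first.
  by exists w => // v Av; rewrite sw; apply: us; exists v.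
apply: (compact_closed (@norm_hausdorff _ K^o) cB) => U.
move=> /nbhs_ballP[d /= d0 dU]; apply: contrapT => BU.
have : s <= s - d.
  apply: ls => _ [w Aw <-].
  have dr : d \is Num.real by exact: gtr0_real.
  rewrite real_leNgt ?(ger0_real (normr_ge0 w)) ?(realB (ger0_real s0) dr)//.
  apply/negP => sw; apply: BU; exists `|w|; split; first by exists w.
  apply: dU; rewrite -ball_normE /= ger0_norm ?subr_ge0; last by apply: us; exists w.
  by rewrite ltrBlDr -ltrBlDl.
by rewrite lerDl oppr_ge0 => /(lt_le_trans d0); rewrite ltxx.
Qed.

Definition polydisc_image (z : nat -> Z) n : set Z :=
  [set \sum_(i < n) t i *: z i | t in [set t : nat -> K^o | forall i, `|t i| <= 1]].

Lemma compact_polydisc_image z n : compact_disc K -> compact (polydisc_image z n).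
Proof.
move=> cD; elim: n => [|n ih].
  rewrite (_ : polydisc_image z 0 = [set 0]); first exact: compact_set1.
  apply/seteqP; split=> [_ [t _ <-]|_ ->]; first by rewrite big_ord0.
  by exists (fun=> 0); rewrite ?big_ord0// => i; rewrite normr0 ler01.
have -> : polydisc_image z n.+1 =
    (fun ws : Z * K^o => ws.1 + ws.2 *: z n) @` (polydisc_image z n `*` [set t | `|t| <= 1]).
  apply/seteqP; split=> [_ [t t1 <-]|_ [[_ s] /= [[t t1 <-] s1] <-]].
    exists (\sum_(i < n) t i *: z i, t n); last by rewrite big_ord_recr.
    by split=> /=; [exists t|exact: t1].
  exists (fun i => if i == n then s else t i).
    by move=> i /=; case: ifP => _ //; exact: t1.
  rewrite big_ord_recr /= eqxx; congr (_ + _).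
  by apply: eq_bigr => i _; rewrite ltn_eqF.
apply: continuous_compact; last exact: compact_setX.
apply: continuous_subspaceT => -[w s]; apply: cvgD; first exact: cvg_fst.
by apply: cvgZl; exact: cvg_snd.
Qed.

End compactness.

Lemma norming_functional (K : numFieldType) (hbK : hahn_banach K) (Z : normedModType K) (z : Z) :
  exists g : Z -> K^o, [/\ linear g, forall w, `|g w| <= `|w| & `|z| <= `|g z| ].
Proof.
have [|||||||g [lg gn _ gz]] := hbK Z (fun w => `|w|) [set 0] z `|z|.
- exact: ler_normD.
- exact: normrZ.
- exact: normr_ge0.
- by [].
- by move=> b _ _ -> ->; rewrite scaler0 addr0.
- by [].
- by move=> _ ->; rewrite addr0.
by exists g.
Qed.

(** * Convergence of the corrections to an exact lifting *)

Section lifting.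
Context {K : numFieldType} (hbK : hahn_banach K) (supK : sup_complete K)
  (geoK : geometric_null K).
Context {X : completeNormedModType K} {a : (X -> K^o) -> nat -> K} {e : nat -> X -> K^o}.
Hypothesis ae : ell1_coordinates a e.

Let e_lin m : linear (e m). Proof. by have [/(_ m)[[]]] := ae. Qed.
Let e_norm m x : `|e m x| <= `|x|. Proof. by have [/(_ m)[]] := ae. Qed.

Let half_ge0 k : 0 <= 2^-1 ^+ k :> K. Proof. by rewrite exprn_ge0 ?invr_ge0. Qed.

(** Approximation of l by arbitrarily late terms suffices to pass norm bounds and coordinate values
    to the limit. *)
Lemma geometric_cauchy (u : nat -> X) (B : K) : 0 < B ->
  (forall k, `|u k.+1 - u k| <= B * 2^-1 ^+ k) ->
  exists l, forall eps, 0 < eps -> forall k, exists2 m, (k <= m)%N & `|l - u m| < eps.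
Proof.
move=> B0 uB.
(* The right-hand side is the exact sum of the geometric bounds from k to k + j - 1, so the
   induction on j closes. *)
have uB' k j : `|u (k + j)%N - u k| <= 2 * B * 2^-1 ^+ k - 2 * B * 2^-1 ^+ (k + j).
  elim: j => [|j ih]; first by rewrite addn0 !subrr normr0.
  have := ler_normD (u (k + j).+1 - u (k + j)%N) (u (k + j)%N - u k).
  rewrite addrA subrK addnS => /le_trans; apply.
  apply: le_trans (lerD (uB _) ih) _.
  suff -> : 2 * B * 2^-1 ^+ (k + j).+1 = B * 2^-1 ^+ (k + j).
    rewrite [leLHS](_ : _ = 2 * B * 2^-1 ^+ k - B * 2^-1 ^+ (k + j))//.
    by ring.
  by rewrite exprS mulrACA divff ?mul1r// pnatr_eq0.
have : cvg (u @ \oo).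
  apply: cauchy_cvg; apply: cauchy_exP => eps /= eps0.
  have [k hk] := geoK (divr_gt0 eps0 (mulr_gt0 (ltr0n K 2) B0)).
  exists (u k); exists k => // m /= km.
  rewrite -ball_normE /= distrC -(subnKC km).
  apply: le_lt_trans (uB' _ _) _; apply: (@le_lt_trans _ _ (2 * B * 2^-1 ^+ k)).
    by rewrite gerBl mulr_ge0// ltW// mulr_gt0.
  by rewrite mulrC -ltr_pdivlMr// mulr_gt0.
move=> /cvg_ex[l ul]; exists l => eps eps0 k.
have /cvgrPdist_lt/(_ eps eps0)[m _ hm] := ul.
by exists (maxn m k); [exact: leq_maxr|apply: hm; exact: leq_maxl].
Qed.

Lemma lifting (c : nat -> K) n : (forall i, (i < n)%N -> `|c i| <= 1) ->
  exists2 x, `|x| <= 1 & forall i, (i < n)%N -> e i x = c i.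
Proof.
move=> c1; have [x0 x0c] := interpolation supK ae c n.
(* Positive, and large enough for |x0| <= 1 + D, the start of the iteration. *)
pose D := `|x0| + 1.
have D0 : 0 < D by rewrite ltr_wpDl.
have Dk k : 0 < D * 2^-1 ^+ k by rewrite mulr_gt0// exprn_gt0// invr_gt0 ltr0n.
pose P k x := (forall i, (i < n)%N -> e i x = c i) /\ `|x| <= 1 + D * 2^-1 ^+ k.
(* Choosing a step for every pair (k, x), with 0 where [P] fails, gives a total function for the
   recursion. *)
have /choice[F FP] : forall kx : nat * X, exists x', P kx.1 kx.2 ->
    P kx.1.+1 x' /\ `|x' - kx.2| <= D * (1 + D) * 2^-1 ^+ kx.1.
  move=> [k x] /=; have [[xc xD]|nP] := pselect (P k x); last by exists 0.
  (* With d = D / 2^k and h = D / 2^(k + 1) <= D, the correction is at most D (1 + D) / 2^k. *)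
  have [y [ny yD xy]] := correction hbK supK ae c1 xc (Dk k) (Dk k.+1) xD.
  exists (x + y) => _; split; last first.
    rewrite addrC addKr; apply: le_trans yD _.
    rewrite mulrAC (ler_wpM2r (half_ge0 k))// (ler_wpM2l (ltW D0))// lerD2l.
    by rewrite (ler_piMr (ltW D0))// exprn_ile1 ?invr_ge0// invf_le1 ?ler1n.
  by split=> // i im; rewrite (linear_funD (@e_lin i)) xc// ny// addr0.
pose u := fix u k := if k is k'.+1 then F (k', u k') else x0.
have uP k : P k (u k).
  elim: k => [|k ih] /=; last by have [] := FP (k, u k) ih.
  by split=> //; rewrite expr0 mulr1 /D addrCA -[leLHS]addr0 lerD2l addr_ge0.
have uD k : `|u k.+1 - u k| <= D * (1 + D) * 2^-1 ^+ k by have [] := FP (k, u k) (uP k).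
have [|l ul] := geometric_cauchy _ uD; first by rewrite mulr_gt0// addr_gt0.
exists l.
  rewrite real_leNgt ?ger0_real//; apply/negP => l1.
  (* Half of the supposed gap |l| - 1 bounds both the excess of u m and the distance from l to u
     m. *)
  have h0 : 0 < (`|l| - 1) / 2 by rewrite divr_gt0 ?subr_gt0.
  have [k hk] := geoK (divr_gt0 h0 D0).
  have [m km lm] := ul _ h0 k.
  have : D * 2^-1 ^+ m < (`|l| - 1) / 2.
    rewrite mulrC -ltr_pdivlMr//; apply: le_lt_trans hk.
    by apply: ler_wiXn2l => //; rewrite ?invr_ge0// invf_le1 ?ler1n.
  move=> hm; have [_ um] := uP m.
  have := ler_normD (u m) (l - u m); rewrite addrC subrK.
  move=> /le_lt_trans/(_ (ler_ltD um lm)) h1.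
  have : 1 + D * 2^-1 ^+ m + (`|l| - 1) / 2 < 1 + ((`|l| - 1) / 2 + (`|l| - 1) / 2).
    by rewrite -addrA ltrD2l ltrD2r.
  rewrite -splitr [1 + (`|l| - 1)]addrC subrK => h2.
  by have := lt_trans h1 h2; rewrite ltxx.
move=> i im; apply/eqP; rewrite -subr_eq0 -normr_le0 real_leNgt ?ger0_real//.
apply/negP => h0; have [m _ lm] := ul _ h0 0%N.
have [/(_ i im) uc _] := uP m.
have := e_norm i (l - u m); rewrite (linear_funB (@e_lin i)) uc => h1.
by have := le_lt_trans h1 lm; rewrite ltxx.
Qed.

End lifting.

(** * Approximation by norm-attaining operators *)

Section property_Ak.
Context {K : numFieldType} (hbK : hahn_banach K) (supK : sup_complete K)
  (geoK : geometric_null K) (discK : compact_disc K).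
Context {X : completeNormedModType K} {a : (X -> K^o) -> nat -> K} {e : nat -> X -> K^o}.
Hypothesis ae : ell1_coordinates a e.

Let e_lin m : linear (e m). Proof. by have [/(_ m)[[]]] := ae. Qed.
Let e_norm m x : `|e m x| <= `|x|. Proof. by have [/(_ m)[]] := ae. Qed.

Section approximation.
Context {Z : completeNormedModType K} (T : X -> Z).
Hypothesis cT : compact_ops T.

Let lT : linear T. Proof. by have [] := cT. Qed.

Lemma compact_small_on_ker d : 0 < d ->
  exists n, forall x, ker e n x -> `|x| <= 1 -> `|T x| <= d.
Proof.
move=> d0; apply: contrapT => nod.
have /choice[x xP] : forall n, exists x, [/\ ker e n x, `|x| <= 1 & d < `|T x| ].
  move=> n; apply: contrapT => nox; apply: nod; exists n => x nx x1.
  rewrite real_leNgt ?ger0_real// ?ltW//; apply/negP => dx; apply: nox.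
  by exists x.
have [_] := cT; rewrite precompactE => cclT.
have [|z [_ zcl]] := cclT ((T \o x) @ \oo) _.
  by exists 0%N => // n _; apply: subset_closure; exists (x n) => //; have [] := xP n.
have [g [lg gn gz]] := norming_functional hbK z.
pose f : X -> K^o := g \o T.
have df : dual f.
  apply/bounded_opsP; split=> [b u v|]; first by rewrite /f /= lT lg.
  have [M clM] := compact_norm_bounded cclT.
  exists M => u u1; apply: le_trans (gn _) (clM _ _).
  by apply: subset_closure; exists u.
(* For a suitable large m, z is d/4-close to T (x m) and |g (T (x m))| < d/4, since x m lies in
   [ker m]. Hence |z| < d/2 and |T (x m)| < 3d/4, against d < |T (x m)|. *)
have d4 : 0 < d / 4 by rewrite divr_gt0.
have [_ _ _ _ /(_ f df _ d4)[n0 fn0]] := ae.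
have [_ [[m n0m <-]]] := zcl ((T \o x) @` [set m | (n0 <= m)%N]) (ball z (d / 4))
  (ex_intro2 _ _ n0 I (fun m n0m => ex_intro2 _ _ m n0m erefl)) (nbhsx_ballx _ _ d4).
rewrite -ball_normE /= => zT.
have [mx x1 dT] := xP m.
have fx : `|g (T (x m))| < d / 4.
  rewrite -[g _]/(f (x m)) (@restE _ _ a e f m) big1 ?add0r; last first.
    by move=> i _; rewrite mx ?ltn_ord// mulr0.
  apply: le_lt_trans (le_opnorm1 supK (rest_dual supK ae m df) x1) _.
  exact: fn0.
have zd : `|z| < d / 4 + d / 4.
  apply: le_lt_trans gz _.
  have -> : g z = g (z - T (x m)) + g (T (x m)) by rewrite -(linear_funD lg) subrK.
  apply: le_lt_trans (ler_normD _ _) _; apply: ltrD => //.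
  exact: le_lt_trans (gn _) zT.
have : `|T (x m)| < d / 4 + (d / 4 + d / 4).
  rewrite -[T _](subrK z); apply: le_lt_trans (ler_normD _ _) _.
  by apply: ltrD => //; rewrite distrC.
move=> /(lt_trans dT).
have {1}-> : d = d / 4 + (d / 4 + d / 4) + d / 4 by field.
by rewrite gtrDl => /(lt_trans d4); rewrite ltxx.
Qed.

Lemma compact_small_on_ker_le d : 0 < d ->
  exists n, forall x C, ker e n x -> 0 < C -> `|x| <= C -> `|T x| <= d * C.
Proof.
move=> /compact_small_on_ker[n nd]; exists n => x C nx C0 xC.
rewrite -ler_pdivrMr// -[C in `|_| / C]gtr0_norm// mulrC -normfV -normrZ.
rewrite -(linear_funZ lT); apply: nd.
  by move=> i im; rewrite linear_funZ// nx// scaler0.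
by rewrite normrZ normfV gtr0_norm// mulrC ler_pdivrMr// mul1r.
Qed.

(** With z i = T (y i), where y i lifts the i-th unit vector, put v = \sum_(i < n) e i x *: y i. The
    difference is T (x - v), and x - v passes through a lifting u of the first n coordinates of x
    padded by zeros: x - u lies in [ker n] with norm at most 2, u - v in [ker N] with norm at most n
    + 1. *)
Lemma finite_rank_approximation d : 0 < d ->
  exists n (z : nat -> Z), forall x, `|x| <= 1 ->
    `|T x - \sum_(i < n) e i x *: z i| <= d.
Proof.
move=> d0.
have d3 : 0 < d / 3 by rewrite divr_gt0.
have [n nd] := compact_small_on_ker_le d3.
(* The norm of u - v is controlled only by n + 1, so N is chosen after n, for a threshold divided by
   n + 1. *)
have dn : 0 < d / 3 / n.+1%:R by rewrite divr_gt0.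
have [N Nd] := compact_small_on_ker_le dn.
pose N' := maxn n N.
have /choice[y yP] : forall i : nat, exists y, `|y| <= 1 /\
    (forall m, (m < N')%N -> e m y = (m == i)%:R).
  move=> i; have [m _|y y1 yE] := @lifting _ hbK supK geoK _ _ _ ae (fun m => (m == i)%:R) N'.
    by case: eqP; rewrite ?normr1// normr0 ler01.
  by exists y.
exists n, (T \o y) => x x1.
have [m _|u u1 uE] :=
  @lifting _ hbK supK geoK _ _ _ ae (fun m => if (m < n)%N then e m x else 0) N'.
  case: ifP => _; first exact: le_trans (e_norm _ _) x1.
  by rewrite normr0 ler01.
pose v := \sum_(i < n) e i x *: y i.
have -> : T x - \sum_(i < n) e i x *: (T \o y) i = T (x - u) + T (u - v).
  rewrite -(linear_funD lT) addrA subrK (linear_funB lT); congr (_ - _).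
  rewrite (linear_fun_sum lT); apply: eq_bigr => i _.
  by rewrite (linear_funZ lT).
have nxu : ker e n (x - u).
  move=> i im; rewrite (linear_funB (@e_lin i)) uE ?im ?subrr//.
  by rewrite leq_max im.
have Nuv : ker e N (u - v).
  move=> m mN; have mN' : (m < N')%N by rewrite leq_max mN orbT.
  rewrite (linear_funB (@e_lin m)) uE// /v (linear_fun_sum (@e_lin m)).
  apply/eqP; rewrite subr_eq0; apply/eqP.
  under eq_bigr => i _ do rewrite (linear_funZ (@e_lin m)) (yP i).2//.
  case: ifPn => [mn|]; last first.
    rewrite -leqNgt => nm; rewrite big1// => i _.
    by rewrite gtn_eqF ?scaler0// (leq_trans (ltn_ord i)).
  rewrite (bigD1 (Ordinal mn))//= eqxx big1 ?addr0 => [|i].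
    by rewrite /GRing.scale /= mulr1.
  by rewrite -val_eqE /= eq_sym => /negbTE ->; rewrite scaler0.
have xu2 : `|x - u| <= 2.
  by apply: le_trans (ler_normB _ _) _; rewrite -[2]/(1 + 1) lerD.
have uvn : `|u - v| <= n.+1%:R.
  apply: le_trans (ler_normB _ _) _; rewrite -nat1r lerD//.
  apply: le_trans (ler_norm_sum _ _ _) _.
  apply: (@le_trans _ _ (\sum_(i < n) 1)); last by rewrite sumr_const card_ord.
  apply: ler_sum => i _; rewrite normrZ -[1]mul1r ler_pM//; last exact: (yP i).1.
  exact: le_trans (e_norm _ _) x1.
apply: le_trans (ler_normD _ _) _.
apply: le_trans (lerD (nd _ _ nxu _ xu2) (Nd _ _ Nuv _ uvn)) _ => //.
by rewrite divfK ?pnatr_eq0// le_eqVlt; apply/orP; left; apply/eqP; field.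
Qed.

End approximation.

(** Liftings of norm at most 1, and not merely 1 + h, put the whole polydisc image inside the image
    of the closed ball. *)
Lemma finite_rank_image (Z : completeNormedModType K) (z : nat -> Z) n :
  (fun x => \sum_(i < n) e i x *: z i) @` @unit_ball K X = polydisc_image z n.
Proof.
apply/seteqP; split=> [_ [x x1 <-]|_ [t t1 <-]].
  by exists (fun i => e i x) => // i; exact: le_trans (e_norm _ _) x1.
have [i _|x x1 xt] := @lifting _ hbK supK geoK _ _ _ ae t n; first exact: t1.
by exists x => //; apply: eq_bigr => i _; rewrite xt.
Qed.

Lemma finite_rank_NA (Z : completeNormedModType K) (z : nat -> Z) n :
  let S x := \sum_(i < n) e i x *: z i in compact_ops S /\ NA S.
Proof.
move=> S.
have lS : linear S.
  move=> b x y; rewrite /S scaler_sumr -big_split /=; apply: eq_bigr => i _.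
  by rewrite e_lin scalerDl scalerA.
have cD : compact (polydisc_image z n) by exact: compact_polydisc_image.
have Sball : S @` @unit_ball K X = polydisc_image z n by exact: finite_rank_image.
have [_ [x0 x01 <-] Smax] : exists2 w, (S @` @unit_ball K X) w &
    forall v, (S @` @unit_ball K X) v -> `|v| <= `|w|.
  apply: compact_norm_max => //; first by rewrite Sball.
  by exists (S 0), 0; rewrite // /unit_ball /= normr0 ler01.
have Smax' x : `|x| <= 1 -> `|S x| <= `|S x0| by move=> x1; apply: Smax; exists x.
have bS : bounded_ops S by apply/bounded_opsP; split=> //; exists `|S x0|.
have nS : opnorm S = `|S x0|.
  by apply/eqP; rewrite eq_le (opnorm_le supK Smax') le_opnorm1.
split; first by split=> //; rewrite Sball; apply: compact_precompact => //; exact: norm_hausdorff.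
split=> //.
(* If S x0 = 0, then S vanishes on the ball and any unit vector will do; one exists because e 0
   takes the value 1. *)
have [S0|S0] := eqVneq (S x0) 0.
  have [v _ ev] := ker_dual_vector supK ae 0.
  have v0 : `|v| != 0.
    rewrite normr_eq0; apply/eqP => v0; move: ev; rewrite v0 linear_fun0// => /esym/eqP.
    by rewrite oner_eq0.
  have v1 : `| `|v|^-1 *: v| = 1 by rewrite normrZ normfV normr_id mulVf.
  exists (`|v|^-1 *: v) => //; rewrite nS; apply/eqP; rewrite eq_le Smax' ?v1// andbT.
  by rewrite S0 normr0.
(* Otherwise |S x0| <= |S x0| * |x0| forces |x0| >= 1. *)
exists x0 => //; apply/eqP; rewrite eq_le x01 /=.
have := le_opnorm supK x0 bS; rewrite nS.
by rewrite ler_pMr// normr_gt0.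
Qed.

Lemma ell1_coordinates_Ak : property_Ak X.
Proof.
move=> Z T cT eps eps0.
have e2 : 0 < eps / 2 by rewrite divr_gt0.
have [n [z Tz]] := finite_rank_approximation cT e2.
have [cS aS] := finite_rank_NA z n.
exists (fun x => \sum_(i < n) e i x *: z i); split=> //.
apply: (@le_lt_trans _ _ (eps / 2)); first exact: opnorm_le.
by rewrite ltr_pdivrMr// ltr_pMr// ltr1n.
Qed.

End property_Ak.

Lemma dual_ell1_Ak (K : numFieldType) (hbK : hahn_banach K) (supK : sup_complete K)
    (geoK : geometric_null K) (discK : compact_disc K) (X : completeNormedModType K) :
  dual_is_ell1 X -> property_Ak X.
Proof.
move=> /(dual_ell1_coordinates supK)[a [e ae]].
exact: ell1_coordinates_Ak ae.
Qed.

Theorem corollary3p8 (R : realType) :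
  (forall X : completeNormedModType R, dual_is_ell1 X -> property_Ak X) /\
  (forall X : completeNormedModType R[i], dual_is_ell1 X -> property_Ak X).
Proof.
split=> X.
- apply: dual_ell1_Ak; [exact: hahn_banachR|exact: sup_completeR|
    exact: geometric_nullR|exact: compact_discR].
- apply: dual_ell1_Ak; [exact: hahn_banachC|exact: sup_completeC|
    exact: geometric_nullC|exact: compact_discC].
Qed.
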